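(* Let $L$ be a finite nonempty ideal (downward closed subset) of the grid poset $(\mathbb{N}^n,\leq)$ with componentwise order, and let $d$ be the VC-dimension of $L$. Then $L$ has a realization in $\mathbb{R}^{2d}$; that is, $\dim_{\mathbb{E}}(L)\leq 2\,\mathrm{VC\text{-}dim}(L)$.
   Context: Here $\mathbb{N}=\{0,1,2,\dots\}$. (Finite nonempty ideals of $(\mathbb{N}^n,\leq)$ correspond bijectively to multisimplicial complexes on an $n$-element set: families of multi-subsets closed under decreasing multiplicities.) A finite nonempty ideal $L$ of $(\mathbb{N}^n,\leq)$ is viewed as a set family as follows: let $U=\{(i,j): 1\leq i\leq n,\ j\geq 1,\ \exists x\in L \text{ with } x_i\geq j\}$ and identify $x\in L$ with the set $\{(i,j)\in U: j\leq x_i\}$. The VC-dimension of a family $\mathcal{S}\subseteq 2^U$ is the maximum size of $X\subseteq U$ with $\{S\cap X:S\in\mathcal{S}\}=2^X$. (For a finite nonempty ideal $L$ of $(\mathbb{N}^n,\leq)$, viewed as the set family $\{\{(i,j)\in U: j\leq x_i\}: x\in L\}$, it equals the dimension of the largest cube in $L$, i.e. the maximum number of nonzero coordinates of an element of $L$.) A realization of a family $\mathcal{S}\subseteq 2^U$ in $\mathbb{R}^m$ consists of oriented affine hyperplanes $(H_e)_{e\in U}$ of $\mathbb{R}^m$, where $H_e=\{x:a_e\cdot x=b_e\}$ with $a_e\neq 0$, $H_e^+=\{x:a_e\cdot x>b_e\}$, $H_e^-=\{x:a_e\cdot x<b_e\}$, and a relatively open convex set $K\subseteq\mathbb{R}^m$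 such that $X\subseteq U$ belongs to $\mathcal{S}$ if and only if there is $x\in K$ with $x\in H_e^+$ for all $e\in X$ and $x\in H_e^-$ for all $e\in U\setminus X$. The Euclidean dimension $\dim_{\mathbb{E}}(\mathcal{S})$ is the smallest $m$ such that $\mathcal{S}$ has a realization in $\mathbb{R}^m$. *)

(* Defs.v *)
From HB Require Import structures.
From mathcomp Require Import all_boot all_order all_algebra finmap.
From mathcomp Require Import all_classical all_reals all_analysis.
Import Order.TTheory GRing.Theory Num.Theory.
Import numFieldNormedType.Exports.

Set Implicit Arguments.
Unset Strict Implicit.
Unset Printing Implicit Defensive.

Local Open Scope classical_set_scope.
Local Open Scope ring_scope.
Local Open Scope fset_scope.

(* A family S of subsets of a finite ground set U is a pair of arguments
   U : {fset T}, S : {fset {fset T}}, the members of S being subsets of U. *)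

Definition shatters (T : choiceType) (S : {fset {fset T}}) (X : {fset T}) :=
  [fset A `&` X | A in S] == fpowerset X.

Definition vc_dim (T : choiceType) (U : {fset T}) (S : {fset {fset T}}) : nat :=
  (\max_(X <- fpowerset U | shatters S X) #|` X|)%N.

Definition dot (R : realType) (m : nat) (u v : 'rV[R]_m) : R :=
  \sum_(i < m) u 0 i * v 0 i.

Definition affine_hull (R : realType) (m : nat) (K : set 'rV[R]_m) :
    set 'rV[R]_m :=
  [set x | exists (k : nat) (c : 'I_k -> R) (p : 'I_k -> 'rV[R]_m),
     [/\ forall i, K (p i), \sum_(i < k) c i = 1
       & x = \sum_(i < k) c i *: p i]].

Definition relatively_open (R : realType) (m : nat) (K : set 'rV[R]_m) :=
  exists2 O : set 'rV[R]_m, open O & K = (O `&` affine_hull K)%classic.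

(* The hyperplanes are H_e = {x | a e . x = b e} for e \in U; the values of
   a and b outside U are irrelevant. *)
Definition is_realization (R : realType) (T : choiceType) (U : {fset T})
    (S : {fset {fset T}}) (m : nat) (a : T -> 'rV[R]_m) (b : T -> R)
    (K : set 'rV[R]_m) : Prop :=
  [/\ forall e, e \in U -> a e != 0,
      convex_set K,
      relatively_open K
    & forall X : {fset T}, X `<=` U ->
        (X \in S <->
         exists x, [/\ K x,
           forall e, e \in X -> b e < dot (a e) x
         & forall e, e \in U `\` X -> dot (a e) x < b e])].

Definition realizable (R : realType) (T : choiceType) (U : {fset T})
    (S : {fset {fset T}}) (m : nat) : Prop :=
  exists (a : T -> 'rV[R]_m) (b : T -> R) (K : set 'rV[R]_m),
    is_realization U S a b K.

(* Relational, since a family may have no realization in any dimension. *)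
Definition is_euclidean_dim (R : realType) (T : choiceType) (U : {fset T})
    (S : {fset {fset T}}) (m : nat) : Prop :=
  realizable R U S m /\ forall k, realizable R U S k -> (m <= k)%N.

Definition is_ideal (n : nat) (L : {fset {ffun 'I_n -> nat}}) : Prop :=
  forall x y : {ffun 'I_n -> nat},
    y \in L -> (forall i, (x i <= y i)%N) -> x \in L.

(* Coordinates are 0-based; the levels j still start at 1. *)
Definition grid_ground (n : nat) (L : {fset {ffun 'I_n -> nat}}) :
    {fset 'I_n * nat} :=
  \bigcup_(x <- L)
    [fset p in [seq (i, j) | i <- enum 'I_n, j <- iota 1 (x i)]].

Definition grid_family (n : nat) (L : {fset {ffun 'I_n -> nat}}) :
    {fset {fset 'I_n * nat}} :=
  [fset [fset p in grid_ground L | (p.2 <= x p.1)%N]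
     | x : {ffun 'I_n -> nat} in L].

Lemma in_grid_ground (n : nat) (L : {fset {ffun 'I_n -> nat}}) (i : 'I_n)
    (j : nat) :
  (i, j) \in grid_ground L <-> (1 <= j)%N /\ exists2 x, x \in L & (j <= x i)%N.
Proof.
rewrite /grid_ground; split.
  case/bigfcupP => x /andP[xL _]; rewrite !inE /= => /allpairsPdep.
  case=> i' [j' [_ + [-> ->]]].
  by rewrite mem_iota add1n ltnS => /andP[j0 jx]; split => //; exists x.
case=> j0 [x xL jx]; apply/bigfcupP; exists x; first by rewrite xL.
rewrite !inE /=; apply/allpairsPdep; exists i, j.
by rewrite mem_enum mem_iota add1n ltnS j0 jx.
Qed.

(* Main.v *)
(* All hyperplanes of coordinate i are parallel, with normal vector the power
   vector (t_i^0, ..., t_i^(2d-1)), t_i = i.  A point y of R^(2d) is read as the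
   polynomial Q = C X^(2d) - sum_k y_k X^k, with C a large constant, and y lies
   on the positive side of H_(i,j) when Q(t_i) < 4 r^j, where r = 1/(4N) and N = #|L|.

   As in the proof that cyclic polytopes are neighborly, an element x of L, which
   has at most d nonzero coordinates, is represented by
   Q = C * (a square vanishing exactly at the t_i with x_i <> 0) + interpolant,
   with Q(t_i) = 2 r^(x_i) on the support of x and Q(t_i) >= 2 elsewhere.  K is the
   set of the y dominated by a convex combination of the profiles (r^(x_i))_i with
   x in L, i.e. Q(t_i) > sum_x c_x r^(x_i) for all i.  Some weight c_x is at least
   1/N, so Q(t_i) > r^(x_i)/N = 4 r^(x_i + 1): the cell of y lies below x, hence
   in L. *)
Require Import Defs.
From mathcomp Require Import all_boot all_order all_algebra finmap.
From mathcomp Require Import all_classical all_reals all_analysis.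
From mathcomp Require Import lra ring.
Import Order.TTheory GRing.Theory Num.Theory.
Import numFieldNormedType.Exports.

Set Implicit Arguments.
Unset Strict Implicit.
Unset Printing Implicit Defensive.

(** * Polynomials with prescribed values at integer nodes *)

Section Interpolation.
Local Open Scope ring_scope.

(** Newton interpolation: nodes are added one at a time, each new value being corrected by a
    multiple of a polynomial vanishing at the earlier nodes. *)
Lemma interpolation (F : fieldType) (I : finType) (t w : I -> F)
    (t_inj : injective t) (A : {set I}) :
  exists r : {poly F}, (size r <= #|A|)%N /\ forall i, i \in A -> r.[t i] = w i.
Proof.
have [k] := ubnP #|A|; elim: k A => // k IH B; rewrite ltnS => leBk.
have [->|[a aB]] := set_0Vmem B.
  by exists 0; rewrite size_poly0; split=> // i; rewrite finset.in_set0.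
pose A := B :\ a; have aA : a \notin A by rewrite finset.in_setD1 eqxx.
rewrite -(finset.setD1K aB) -/A; have [|r [sr rA]] := IH A.
  by move: leBk; rewrite (finset.cardsD1 a B) aB.
pose v := \prod_(j in A) ('X - (t j)%:P).
have va : v.[t a] != 0.
  rewrite horner_prod; apply/prodf_neq0 => j jA.
  rewrite hornerXsubC subr_eq0 (inj_eq t_inj).
  by apply: contraNneq aA => ->.
exists (r + ((w a - r.[t a]) / v.[t a]) *: v).
split.
  rewrite cardsU1 aA add1n.
  apply: (leq_trans (size_polyD _ _)); rewrite geq_max leqW //=.
  apply: (leq_trans (size_scale_leq _ _)).
  by rewrite /v -big_enum size_prod_XsubC -cardE.
move=> i; rewrite in_setU1 hornerD hornerZ => /orP[/eqP->|iA].
  by rewrite divfK // addrC subrK.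
rewrite (_ : v.[t i] = 0) ?mulr0 ?addr0 ?rA //.
rewrite horner_prod (bigD1 i) //= hornerXsubC subrr mul0r //.
Qed.

Lemma monic_vanishing_natr (R : realFieldType) (n d : nat) (A : {set 'I_n})
    (leAd : (#|A| <= d)%N) :
  exists q : {poly R}, [/\ q \is monic, size q = (2 * d).+1,
    forall i : 'I_n, i \in A -> q.[i%:R] = 0
  & forall i : 'I_n, i \notin A -> 1 <= q.[i%:R]].
Proof.
(* At a natural number that is not a root, each factor has absolute value at least 1. The power of
   [X + 1] pads the degree to exactly [d]. *)
pose v : {poly R} := \prod_(j in A) ('X - (j%:R)%:P) * ('X - (- 1)%:P) ^+ (d - #|A|).
have mv : v \is monic by rewrite monicMl ?monic_prod_XsubC ?monic_exp ?monicXsubC.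
have sv : size v = d.+1.
  rewrite size_Mmonic ?monic_exp ?monicXsubC //; last first.
    by rewrite monic_neq0 ?monic_prod_XsubC.
  by rewrite -big_enum size_prod_XsubC size_exp_XsubC -cardE addnS /= addSn subnKC.
have nat_sq (k : nat) : k != 0%N -> 1 <= `|k%:R : R|.
  by rewrite normr_nat (ler_nat R 1) lt0n.
exists (v ^+ 2); split.
- exact: monic_exp.
- by rewrite expr2 size_Mmonic ?monic_neq0 // sv addSn addnS /= addnn mul2n.
- move=> i iA; rewrite horner_exp hornerM horner_prod (bigD1 i) //=.
  by rewrite hornerXsubC subrr !mul0r expr0n.
- move=> i iA; rewrite horner_exp -real_normK ?num_real// exprn_ege1//.
  rewrite hornerM normrM mulr_ege1 //.
    rewrite horner_prod normr_prod.
    apply: (big_ind (fun x : R => 1 <= x)) => // [x y|j jA]; first exact: mulr_ege1.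
    rewrite hornerXsubC; have : i != j by apply: contraNneq iA => ->.
    rewrite -val_eqE /=; move: (i : nat) (j : nat) => k l nkl.
    wlog: k l nkl / (l < k)%N.
      move=> H; have := nkl; rewrite neq_ltn => /orP[kl|]; last exact: H.
      by rewrite distrC; apply: H => //; rewrite eq_sym.
    by move=> lk; rewrite -natrB 1?ltnW// nat_sq// -lt0n subn_gt0.
  by rewrite horner_exp normrX exprn_ege1// hornerXsubC opprK natr1 nat_sq.
Qed.

(* The leading coefficient [C] is kept independent of the prescribed data, so
   that all the polynomials lie in one affine space of dimension [2 * d]. *)
Lemma prescribed_values (R : realFieldType) (n d : nat) (A : {set 'I_n})
    (w : 'I_n -> R) (leAd : (#|A| <= d)%N) :
  exists C0 : R, forall C, C0 <= C -> exists p : {poly R},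
    [/\ (size p <= 2 * d)%N,
       forall i : 'I_n, i \in A -> C * i%:R ^+ (2 * d) - p.[i%:R] = w i
     & forall i : 'I_n, i \notin A -> 2 <= C * i%:R ^+ (2 * d) - p.[i%:R]].
Proof.
have natr_ord_inj : injective (fun i : 'I_n => i%:R : R).
  by move=> i j /eqP; rewrite eqr_nat => /eqP/val_inj.
have [r [sr rA]] := interpolation w natr_ord_inj A.
have [q [mq sq qA qnA]] := monic_vanishing_natr R leAd.
(* Outside [A] the value [C * q + r] is at least [C - |r|], so this bound leaves 2. *)
exists (2 + \sum_(i < n) `|r.[i%:R]|) => C leC.
(* Chosen so that [C * X^(2d) - p = C * q + r]; the terms of degree [2 * d] cancel as [q] is
   monic. *)
exists (C *: ('X^(2 * d) - q) - r); split.
- apply/(leq_trans (size_polyD _ _)); rewrite geq_max size_polyN.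
  rewrite (leq_trans sr) ?(leq_trans leAd) ?leq_pmull // andbT.
  apply: (leq_trans (size_scale_leq _ _)).
  apply/leq_sizeP => j; rewrite leq_eqVlt => /orP[/eqP <-|dj].
    rewrite coefB coefXn eqxx.
    by move/monicP: mq; rewrite lead_coefE sq /= => ->; rewrite subrr.
  by rewrite coefB coefXn gtn_eqF// (nth_default 0) ?sq ?subrr.
- move=> i iA; rewrite !hornerE rA // qA //; ring.
- move=> i iA; rewrite !hornerE.
  have leri : `|r.[i%:R]| <= \sum_(i < n) `|r.[i%:R]|.
    by rewrite (bigD1 i) //= lerDl sumr_ge0.
  have s0 : 0 <= \sum_(i < n) `|r.[i%:R]| by rewrite sumr_ge0.
  have Cq : C <= C * q.[i%:R] by rewrite ler_peMr ?qnA //; lra.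
  have := ler_norm (- r.[i%:R]); rewrite normrN; lra.
Qed.

Lemma dot_powers (R : realType) (m : nat) (x : R) (p : {poly R}) :
  (size p <= m)%N -> dot (\row_(k < m) x ^+ k) (\row_(k < m) p`_k) = p.[x].
Proof.
move=> sp; rewrite (horner_coef_wide _ sp); apply: eq_bigr => i _.
by rewrite !mxE mulrC.
Qed.

Lemma continuous_dot (R : realType) (m : nat) (u : 'rV[R]_m) :
  continuous (dot u).
Proof.
have cont_term i : continuous (fun v : 'rV[R]_m => u 0 i * v 0 i).
  move=> x; apply: (@continuousM R 'rV[R]_m (cst (u 0 i)) (fun v => v 0 i)).
    exact: cst_continuous.
  exact: coord_continuous.
have := @continuous_big R 'I_m +%R 0 xpredT (@add_continuous R) 'rV[R]_m
  (index_enum 'I_m) (fun i v => u 0 i * v 0 i).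
by apply=> i _; exact: cont_term.
Qed.

End Interpolation.

(** * Points lying below a convex combination of profiles *)

Section HullRegion.
Local Open Scope ring_scope.
Variables (R : realType) (m n : nat) (T : choiceType) (L : {fset T}).
Variables (a : 'I_n -> 'rV[R]_m) (u : T -> 'I_n -> R).

Definition convex_weights (c : T -> R) : Prop :=
  (forall x, 0 <= c x) /\ \sum_(x <- L) c x = 1.

Definition hull_region : set 'rV[R]_m :=
  [set y | exists2 c, convex_weights c
     & forall i, dot (a i) y < \sum_(x <- L) c x * u x i]%classic.

Lemma dotD (v x y : 'rV[R]_m) : dot v (x + y) = dot v x + dot v y.
Proof.
by rewrite /dot -big_split; apply: eq_bigr => i _; rewrite mxE mulrDr.
Qed.

Lemma dotZ (v x : 'rV[R]_m) (k : R) : dot v (k *: x) = k * dot v x.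
Proof.
by rewrite /dot mulr_sumr; apply: eq_bigr => i _; rewrite mxE mulrCA.
Qed.

Lemma convex_hull_region : convex_set hull_region.
Proof.
move=> x y t; rewrite !inE => -[c [c0 c1] cx] [e [e0 e1] ey].
have t0 : 0 <= t%:num by [].
have t1 : 0 <= 1 - t%:num by rewrite subr_ge0.
exists (fun z => t%:num * c z + (1 - t%:num) * e z).
  split=> [z|]; first by rewrite addr_ge0 // mulr_ge0.
  by rewrite big_split /= -!mulr_sumr c1 e1; ring.
move=> i; 
have -> : conv t x y = t%:num *: (x : 'rV[R]_m) + (1 - t%:num) *: y :> 'rV[R]_m.
  by [].
have -> : \sum_(z <- L) (t%:num * c z + (1 - t%:num) * e z) * u z i =
   t%:num * (\sum_(z <- L) c z * u z i) +
   (1 - t%:num) * (\sum_(z <- L) e z * u z i).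
  by rewrite !mulr_sumr -big_split; apply: eq_bigr => z _ /=; ring.
rewrite dotD !dotZ.
(* At weight 0 strictness comes from the second point alone; otherwise the first supplies it. *)
have [/eqP t00|t00] := boolP (t%:num == 0).
  by rewrite t00 !mul0r !add0r subr0 !mul1r.
apply: ltr_leD; first by rewrite ltr_pM2l // lt_neqAle eq_sym t00.
by apply: ler_wpM2l => //; exact: ltW.
Qed.

Lemma open_hull_region : open hull_region.
Proof.
have -> : hull_region = (\bigcup_(c in convex_weights)
    [set y | forall i, dot (a i) y < \sum_(x <- L) c x * u x i])%classic.
  by apply/seteqP; split=> [y [c cw cy]|y [c cw cy]]; exists c.
apply: bigcup_open => c _; rewrite openE => y /= cy.
apply: (@filter_forall _ _ (fun i y => dot (a i) y < \sum_(x <- L) c x * u x i)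
  (nbhs y)) => i.
pose D := [set z : R | z < \sum_(x <- L) c x * u x i]%classic.
have : open (dot (a i) @^-1` D)%classic.
  by apply: open_comp => [z _|]; [exact: continuous_dot|exact: open_lt].
by rewrite openE => /(_ y (cy i)).
Qed.

(** Were every weight below the average, they would sum to less than 1. *)
Lemma convex_weights_heavy (c : T -> R) : convex_weights c ->
  exists2 x, x \in L & #|` L|%:R^-1 <= c x.
Proof.
move=> [c0 c1]; apply: contrapT => H.
have N0 : L != fset0.
  by apply/eqP => L0; move: c1; rewrite L0 big_seq_fset0 => /eqP; rewrite eq_sym oner_eq0.
have [z zL] : exists z, z \in L by apply/fset0Pn.
have lt_c x : x \in L -> c x < #|` L|%:R^-1.
  by move=> xL; rewrite ltNge; apply/negP => ?; apply: H; exists x.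
have : \sum_(x <- L) c x < \sum_(x <- L) (#|` L|%:R^-1 : R).
  rewrite (big_fsetD1 z) //= [ltRHS](big_fsetD1 z) //=; apply: ltr_leD; first exact: lt_c.
  rewrite big_seq [leRHS]big_seq; apply: ler_sum => x.
  by rewrite inE => /andP[_ xL]; exact/ltW/lt_c.
rewrite c1 big_const_seq count_predT iter_addr_0 -[ltRHS]mulr_natr mulVf ?ltxx //.
by rewrite pnatr_eq0 cardfs_eq0.
Qed.

End HullRegion.

Lemma open_relatively_open (R : realType) (m : nat) (K : set 'rV[R]_m) :
  open K -> relatively_open K.
Proof.
move=> oK; exists K => //; apply/seteqP; split=> [x Kx|x []//].
split=> //; exists 1, (fun=> 1%R), (fun=> x); split=> //.
- by rewrite big_ord1.
- by rewrite big_ord1 scale1r.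
Qed.

(** * Support size and VC-dimension of an ideal *)

Section Grid.
Local Open Scope fset_scope.
Variables (n : nat) (L : {fset {ffun 'I_n -> nat}}).

Lemma grid_familyP (X : {fset 'I_n * nat}) :
  reflect (exists2 x : {ffun 'I_n -> nat}, x \in L &
             X = [fset p in grid_ground L | p.2 <= x p.1])
          (X \in grid_family L).
Proof. exact: imfsetP. Qed.

Hypothesis L_ideal : is_ideal L.

(** The elements [(i, 1)] over the support of [x] form a shattered set, since [L] contains every 0/1
    vector below [x]. *)
Lemma card_support_le_vc_dim (x : {ffun 'I_n -> nat}) : x \in L ->
  #|[set i | x i != 0]| <= vc_dim (grid_ground L) (grid_family L).
Proof.
move=> xL; pose A := [set i | x i != 0].
pose X : {fset 'I_n * nat} := [fset (i, 1) | i in A].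
have XP p : (p \in X) = (p.2 == 1) && (x p.1 != 0).
  apply/imfsetP/andP => [[i /= iA ->]|[p1 p2]] /=.
    by move: iA; rewrite inE.
  by exists p.1; rewrite /= ?inE //; case: p p1 {p2} => i j /= /eqP->.
have XU : X `<=` grid_ground L.
  apply/fsubsetP => -[i j]; rewrite XP /= => /andP[/eqP -> xi].
  by apply/in_grid_ground; split=> //; exists x => //; rewrite lt0n.
have cX : #|` X| = #|A|.
  rewrite card_imfset /= ?cardE //.
  by move=> i j [].
rewrite -/A -cX /vc_dim; apply: (bigmaxn_sup_seq X) => //; first by rewrite fpowersetE.
apply/eqP/fsetP => Y; rewrite fpowersetE; apply/imfsetP/idP.
  by move=> [B _ ->]; exact: fsubsetIr.
move=> YX.
pose y : {ffun 'I_n -> nat} := [ffun i => ((i, 1) \in Y : nat)].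
exists [fset p in grid_ground L | p.2 <= y p.1].
  apply/grid_familyP; exists y => //; apply: L_ideal xL _ => i.
  rewrite ffunE; case: (boolP (_ \in Y)) => // /(fsubsetP YX).
  by rewrite XP /= lt0n.
apply/fsetP => -[i j]; rewrite !inE /= ffunE XP /=.
apply/idP/andP => [ijY|[/andP[_ le1] /andP[/eqP j1 _]]].
  have ijX := fsubsetP YX _ ijY; have ijU := fsubsetP XU _ ijX.
  move: ijX; rewrite XP /= => /andP[/eqP j1 xi]; subst j.
  by rewrite ijU ijY xi.
by move: le1; rewrite j1; case: (boolP (_ \in Y)).
Qed.

End Grid.

(** * Realization by classes of parallel hyperplanes *)

Section GridRealization.
Local Open Scope ring_scope.
Local Open Scope fset_scope.
Variables (R : realType) (m n : nat) (L : {fset {ffun 'I_n -> nat}}).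
Hypotheses (L_ideal : is_ideal L) (L_nonempty : L != fset0).

Definition ratio : R := (4 * #|` L|%:R)^-1.

Lemma card_ge1 : 1 <= #|` L|%:R :> R.
Proof. by rewrite (ler_nat R 1) lt0n cardfs_eq0. Qed.

Lemma ratio_gt0 : 0 < ratio.
Proof. by rewrite invr_gt0; have := card_ge1; lra. Qed.

Lemma ratio_le : 4 * ratio <= 1.
Proof.
rewrite /ratio invfM mulrA divff ?mul1r ?invf_le1 ?card_ge1 ?pnatr_eq0 //.
by apply: lt_le_trans card_ge1.
Qed.

Lemma card_inv_ratio : #|` L|%:R^-1 = 4 * ratio.
Proof. by rewrite /ratio invfM mulrA divff ?mul1r ?pnatr_eq0. Qed.

Lemma ratio_exp_le (j k : nat) : (j <= k)%N -> ratio ^+ k <= ratio ^+ j.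
Proof.
move=> jk; apply: ler_wiXn2l => //; first exact/ltW/ratio_gt0.
by have := ratio_le; have := ratio_gt0; lra.
Qed.

(** [s i - dot (a i) y] stands for Q(t_i); at [pt x] the hypotheses make it at least
    [2 * ratio ^+ x i], with equality on the support. *)
Variables (a : 'I_n -> 'rV[R]_m) (s : 'I_n -> R).
Variable pt : {ffun 'I_n -> nat} -> 'rV[R]_m.
Hypothesis a_neq0 : forall e, e \in grid_ground L -> a e.1 != 0.
Hypothesis pt_le : forall x i, x \in L -> dot (a i) (pt x) <= s i - 2 * ratio ^+ x i.
Hypothesis pt_ge : forall x i, x \in L -> x i != 0%N ->
  s i - 2 * ratio ^+ x i <= dot (a i) (pt x).

Let b (e : 'I_n * nat) : R := s e.1 - 4 * ratio ^+ e.2.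
Let K := hull_region L a (fun x i => s i - ratio ^+ x i).

Lemma pt_hull_region x : x \in L -> K (pt x).
Proof.
move=> xL; exists (fun z => (z == x)%:R).
  split=> [z|]; first by rewrite ler0n.
  rewrite (big_fsetD1 x) //= eqxx big_seq big1 ?addr0 // => z.
  by rewrite in_fsetD1 => /andP[/negPf -> _].
move=> i; rewrite (big_fsetD1 x) //= eqxx mul1r big_seq big1 ?addr0 => [|z].
  by have := pt_le i xL; have := exprn_gt0 (x i) ratio_gt0; lra.
by rewrite in_fsetD1 => /andP[/negPf -> _]; rewrite mul0r.
Qed.

(** A heavy [x] alone contributes at least [4 * ratio * ratio ^+ x i]; the other terms are
    nonnegative and dropped. *)
Lemma hull_region_bound y : K y ->
  exists2 x, x \in L & forall i, dot (a i) y < s i - 4 * ratio ^+ (x i).+1.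
Proof.
move=> [c cw cy]; have [x xL cx] := convex_weights_heavy cw; case: cw => c0 c1.
exists x => // i; apply: (lt_le_trans (cy i)).
under eq_bigr do rewrite mulrBr.
rewrite sumrB -mulr_suml c1 mul1r lerD2l lerN2 (big_fsetD1 x) //= exprS mulrA.
rewrite -card_inv_ratio -[leLHS]addr0 lerD //.
  by apply: ler_wpM2r => //; exact/exprn_ge0/ltW/ratio_gt0.
by apply: sumr_ge0 => z _; rewrite mulr_ge0 //; exact/exprn_ge0/ltW/ratio_gt0.
Qed.

Lemma grid_realization : is_realization (grid_ground L) (grid_family L)
  (fun e => a e.1) b K.
Proof.
split=> //; first exact: convex_hull_region.
  exact/open_relatively_open/open_hull_region.
move=> X XU; split.
  case/grid_familyP => x xL XE; exists (pt x); split; first exact: pt_hull_region.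
    move=> [i j]; rewrite XE !inE /b /= => /andP[/in_grid_ground[j0 _] jx].
    (* Levels start at 1, so [i] is in the support, where [pt_ge] applies. *)
    have x0 : x i != 0%N by rewrite -lt0n (leq_trans j0).
    have := pt_ge xL x0; have := ratio_exp_le jx.
    by have := exprn_gt0 j ratio_gt0; lra.
  move=> [i j]; rewrite inE XE !inE /b /= => /andP[+ ijU].
  rewrite ijU /= -ltnNge => xj; have := pt_le i xL; have := ratio_exp_le xj.
  have x0 := exprn_gt0 (x i) ratio_gt0.
  (* One level above [x i] the threshold has already dropped below [2 * ratio ^+ x i]. *)
  have : 4 * ratio * ratio ^+ x i <= 1 * ratio ^+ x i.
    by apply: ler_wpM2r; [exact: ltW|exact: ratio_le].
  by rewrite exprS; lra.
case=> y [/hull_region_bound [x xL yx] Xon Xoff].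
have Xx e : e \in X -> (e.2 <= x e.1)%N.
  move=> /Xon; rewrite /b leqNgt => ylo; apply/negP => /ratio_exp_le.
  by have := yx e.1; lra.
(* Thresholds decrease with the level, so the positive side at [k] lies within the positive side at
   [j]. *)
have X_down i j k : (0 < j <= k)%N -> (i, k) \in X -> (i, j) \in X.
  move=> /andP[j0 jk] ikX; apply: contraT => ijX.
  have /in_grid_ground[_ [z zL kz]] := fsubsetP XU _ ikX.
  have ijU : (i, j) \in grid_ground L.
    by apply/in_grid_ground; split=> //; exists z => //; exact: leq_trans kz.
  have := Xon _ ikX; have := Xoff (i, j); rewrite in_fsetD ijX => /(_ ijU).
  by rewrite /b /=; have := ratio_exp_le jk; lra.
(* The top level of [X] in column [i], or 0 if there is none; by [Xx] the range up to [x i] misses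
   no level. *)
pose z : {ffun 'I_n -> nat} :=
  [ffun i => \max_(k < (x i).+1 | (i, k : nat) \in X) k]%N.
have zL : z \in L.
  apply: L_ideal xL _ => i; rewrite ffunE; apply/bigmax_leqP => k _.
  by rewrite -ltnS.
apply/grid_familyP; exists z => //; apply/fsetP => -[i j]; rewrite !inE /= ffunE.
apply/idP/andP => [ijX|[ijU]].
  split; first exact: (fsubsetP XU).
  have jx : (j < (x i).+1)%N by rewrite ltnS; exact: (Xx (i, j)).
  by apply: (leq_bigmax_cond (Ordinal jx)).
have j0 : (0 < j)%N by case/in_grid_ground: ijU.
(* If [(i, j)] is not in [X], downward closure keeps every level of [X] in column [i] below [j]. *)
apply: contraTT => ijX; rewrite -ltnNge -(prednK j0) ltnS.
apply/bigmax_leqP => k ikX; rewrite -ltnS prednK // ltnNge.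
by apply: contra ijX => jk; apply: X_down ikX; rewrite j0.
Qed.

End GridRealization.

(** * Realization in dimension [2 * d] from polynomials *)

Lemma realizable_grid (R : realType) (n d : nat) (L : {fset {ffun 'I_n -> nat}}) :
  L != fset0 -> is_ideal L ->
  (forall x, x \in L -> #|[set i | x i != 0]| <= d) ->
  realizable R (grid_ground L) (grid_family L) (2 * d).
Proof.
move=> L0 L_ideal supp_le; pose r := @ratio R n L.
pose ok (C : R) (x : {ffun 'I_n -> nat}) (p : {poly R}) :=
  [/\ (size p <= 2 * d)%N,
     forall i, x i != 0 -> (C * i%:R ^+ (2 * d) - p.[i%:R] = 2 * r ^+ x i)%R
   & forall i, x i = 0 -> (2 <= C * i%:R ^+ (2 * d) - p.[i%:R])%R].
have /choice[C0 C0P] (x : {ffun 'I_n -> nat}) : exists C0, x \in L ->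
    forall C, (C0 <= C)%R -> exists p, ok C x p.
  have [xL|] := boolP (x \in L); last by exists 0%R.
  have [c cP] := prescribed_values (fun i => 2 * r ^+ x i)%R (supp_le x xL).
  exists c => _ C /cP[p [sp pA pnA]]; exists p; split=> // i xi.
    by apply: pA; rewrite inE.
  by apply: pnA; rewrite inE xi.
(* A single leading coefficient must serve all [x] in [L], so it dominates every [C0 x]. *)
pose C := (\sum_(x <- L) `|C0 x|)%R.
have C0_le x : x \in L -> (C0 x <= C)%R.
  move=> xL; rewrite /C (big_fsetD1 x) //= (le_trans (ler_norm _)) // lerDl.
  exact: sumr_ge0.
have /choice[p pP] (x : {ffun 'I_n -> nat}) : exists p, x \in L -> ok C x p.
  have [xL|] := boolP (x \in L); last by exists 0%R.
  by have [q qP] := C0P x xL C (C0_le x xL); exists q => _.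
pose a (i : 'I_n) : 'rV[R]_(2 * d) := (\row_(k < 2 * d) i%:R ^+ k)%R.
pose s (i : 'I_n) : R := (C * i%:R ^+ (2 * d))%R.
pose pt x : 'rV[R]_(2 * d) := (\row_(k < 2 * d) (p x)`_k)%R.
exists (fun e => a e.1).
eexists; eexists; apply: (@grid_realization R _ n L L_ideal L0 a s pt).
- move=> [i j] /in_grid_ground [j0 [x xL jx]] /=.
  (* A ground element forces a nonempty support, so coordinate 0 of [a i] exists; it is a zeroth
     power, hence 1. *)
  have d0 : 0 < 2 * d.
    rewrite muln_gt0 /= (leq_trans _ (supp_le x xL)) // card_gt0.
    by apply/set0Pn; exists i; rewrite inE -lt0n (leq_trans j0).
  apply/eqP => /matrixP /(_ 0%R (Ordinal d0)) /eqP.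
  by rewrite !mxE expr0 oner_eq0.
- move=> x i xL; have [sp pn p0] := pP x xL; rewrite dot_powers //.
  (* Off the support the required bound is [2 * r ^+ 0 = 2]. *)
  have [x0|x0] := eqVneq (x i) 0; first by rewrite x0 /s; have := p0 i x0; lra.
  by rewrite /s -/r -(pn i x0); lra.
- move=> x i xL x0; have [sp pn _] := pP x xL; rewrite dot_powers //.
  by rewrite /s -/r -(pn i x0); lra.
Qed.

Theorem theorem43 (R : realType) (n : nat) (L : {fset {ffun 'I_n -> nat}})
    (L_nonempty : L != fset0) (L_ideal : is_ideal L) :
  let U := grid_ground L in
  let S := grid_family L in
  let d := vc_dim U S in
  realizable R U S (2 * d)
  /\ exists2 m : nat, is_euclidean_dim R U S m & (m <= 2 * d)%N.
Proof.
move=> U S d.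
have real2d : realizable R U S (2 * d).
  by apply: realizable_grid => // x; exact: card_support_le_vc_dim.
split=> //.
have exm : exists k, `[< realizable R U S k >] by exists (2 * d); exact/asboolP.
have [m /asboolP mreal mmin] := ex_minnP exm.
exists m; last by apply: mmin; exact/asboolP.
by split=> // k /asboolP; exact: mmin.
Qed.
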